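(* Let $\mathcal{H}_M$ be a (real or complex) Hilbert space of finite dimension $M$, and let $\{\varphi_i\}_{i=1}^N$ be a unit norm tight frame in $\mathcal{H}_M$. For any $x\in\mathcal{H}_M$ with $\|x\|=1$, let $a=(a_i)_{i=1}^N\in\mathbb{R}^N$ be the sequence $(|\langle x,\varphi_i\rangle|^2)_{i=1}^N$ rearranged in non-increasing order, and set $b:=\left(\frac1M,\frac1M,\ldots,\frac1M\right)\in\mathbb{R}^N$. Then $a\succ_W b$.
   Context: A family $\{\varphi_i\}_{i=1}^N$ in $\mathcal{H}_M$ is a tight frame if there is a constant $A>0$ with $\sum_{i=1}^N|\langle x,\varphi_i\rangle|^2=A\|x\|^2$ for all $x\in\mathcal{H}_M$; it is unit norm if $\|\varphi_i\|=1$ for all $i$. For vectors $a=(a_i)_{i=1}^N$ and $b=(b_i)_{i=1}^N$ with non-negative, non-increasing components, $a$ weakly majorizes $b$, written $a\succ_W b$, if $\sum_{i=1}^k a_i\ge\sum_{i=1}^k b_i$ for all $k\in\{1,\ldots,N\}$. *)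

(* Defs.v *)
From mathcomp Require Import all_boot all_order all_algebra.
From mathcomp Require Import reals complex.

Set Implicit Arguments.
Unset Strict Implicit.
Unset Printing Implicit Defensive.

Import Order.TTheory GRing.Theory Num.Theory.
Local Open Scope ring_scope.

Section Frames.

(* Only two instances of (K, theta, re) are intended: (R, idfun, idfun) and
   (R[i], Num.conj, Re).  MathComp norms of K are K-valued, and [re] sends the
   real elements of K back to R. *)
Variables (R : realType) (K : numFieldType) (theta : K -> K) (re : K -> R).
Variables (H : vectType K) (ip : {dot H for theta}).

Definition ip_norm (x : H) : R := Num.sqrt (re (ip x x)).

Section Family.
Variables (N : nat) (phi : 'I_N -> H).

Definition sq_coefs (x : H) : N.-tuple R :=
  [tuple re `|ip x (phi i)| ^+ 2 | i < N].

Definition tight_frame : Prop :=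
  exists2 A : R, 0 < A &
    forall x : H, \sum_(i < N) tnth (sq_coefs x) i = A * ip_norm x ^+ 2.

Definition unit_norm : Prop := forall i : 'I_N, ip_norm (phi i) = 1.

End Family.

End Frames.

Section Majorization.
Variables (R : realType) (N : nat).
Implicit Types a b : N.-tuple R.

Definition nonincreasing_rearrangement a : N.-tuple R :=
  [tuple of sort >=%R a].

Definition nonneg_nonincreasing a : Prop :=
  (forall i : 'I_N, 0 <= tnth a i) /\
  (forall i j : 'I_N, (i <= j)%N -> tnth a j <= tnth a i).

(* Weak majorization is only defined for vectors with non-negative,
   non-increasing components, hence the first two conjuncts. *)
Definition weakly_majorizes a b : Prop :=
  [/\ nonneg_nonincreasing a, nonneg_nonincreasing b &
    forall k : nat, (1 <= k <= N)%N ->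
      \sum_(i < N | (i < k)%N) tnth a i >= \sum_(i < N | (i < k)%N) tnth b i].

End Majorization.

(* Main.v *)
Require Import Defs.
From mathcomp Require Import all_boot all_order all_algebra.
From mathcomp Require Import reals complex.

Set Implicit Arguments.
Unset Strict Implicit.
Unset Printing Implicit Defensive.

Import Order.TTheory GRing.Theory Num.Theory.
Local Open Scope ring_scope.

(* Summing the tight frame identity over an orthogonal basis e_1, ..., e_M,
   with weights 1 / <e_j, e_j>, and using Parseval for each unit vector phi_i,
   the double sum of |<e_j, phi_i>|^2 / <e_j, e_j> equals both A M and N, so
   A = N / M.  Hence for a unit vector x the N numbers |<x, phi_i>|^2 have
   mean 1 / M, and the mean of the k largest of them is at least the mean of
   all of them. *)

Section OrthogonalBasis.
Variables (K : numFieldType) (theta : {rmorphism K -> K}).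
(** This identity holds for [idfun] over the reals and for conjugation over the complex numbers, so
    one argument serves both cases. *)
Hypothesis sqr_normE : forall z : K, `|z| ^+ 2 = z * theta z.
Variables (H : vectType K) (ip : {dot H for theta}).

Lemma dot_gt0 (u : H) : u != 0 -> 0 < ip u u.
Proof. exact: neq0_dnorm_gt0. Qed.

Lemma dot_ge0 (u : H) : 0 <= ip u u.
Proof.
have [->|/dot_gt0/ltW //] := eqVneq u 0.
by rewrite linear0r.
Qed.

Lemma dot_normC (u v : H) : `|ip u v| = `|ip v u|.
Proof.
have sym (a b : H) : theta (ip a b) = ip b a.
  by rewrite (hermC ip b a) expr0 mul1r.
by apply/eqP; rewrite -(eqrXn2 (n := 2))// !sqr_normE !sym mulrC.
Qed.

(** Pythagoras: the projection of [u] onto the line of [v] is orthogonal to the remainder. *)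
Lemma dot_proj (u v : H) : v != 0 ->
  ip u u = `|ip u v| ^+ 2 / ip v v
           + ip (u - (ip u v / ip v v) *: v) (u - (ip u v / ip v v) *: v).
Proof.
move=> v0; have vv := dot_gt0 v0.
set c := ip u v / ip v v; set w := u - c *: v.
have wv : ip w v = 0.
  by rewrite /w linearBl/= linearZl/= /c mulfVK ?subrr ?gt_eqF.
have cvw : ip (c *: v) w = 0.
  by apply/eqP; rewrite herm_eq0C linearZr/= wv mulr0.
rewrite -[in LHS](subrKC (c *: v) u) -/w hnormDd//; congr (_ + _).
rewrite linearZl/= linearZr/= mulrA -sqr_normE normrM exprMn normfV.
by rewrite (gtr0_norm vv) expr2 -!mulrA mulVf ?mulr1 ?gt_eqF.
Qed.

(** Gram-Schmidt by induction on the dimension. The vectors are left unnormalised, since [K] may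
    lack the square roots needed; the weights [1 / ip e e] compensate. *)
Lemma parseval_subspace (V : {vspace H}) :
  exists2 s : seq H, size s = \dim V &
    [/\ {subset s <= V}, 0 \notin s &
      {in V, forall u, ip u u = \sum_(e <- s) `|ip u e| ^+ 2 / ip e e}].
Proof.
elim: {V}(\dim V) {-2}V (erefl (\dim V)) => [|n IH] V dV.
  exists [::] => //; split=> // u.
  have -> : V = 0%VS by apply/eqP; rewrite -dimv_eq0 dV.
  by rewrite memv0 => /eqP->; rewrite big_nil linear0r.
have V0 : V != 0%VS by rewrite -dimv_eq0 dV.
set v := vpick V; have v0 : v != 0 by rewrite vpick0.
have vV : v \in V := memv_pick V.
(* As [v] is not orthogonal to itself, cutting [V] by its orthogonal complement lowers the dimension
   by exactly one. *)
have vNo : v \notin orthov ip V.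
  by apply/mem_orthovPn; exists v; rewrite // gt_eqF ?dot_gt0.
set W := (V :&: orthov ip <[v]>)%VS.
have dW : \dim W = n by rewrite -eq_dim_orthov1// dV.
have [s ss [sW s0 sP]] := IH W dW.
exists (v :: s); first by rewrite /= ss dW dV.
split.
- by move=> e; rewrite inE => /predU1P[->//|/sW]; rewrite memv_cap => /andP[].
- by rewrite inE negb_or eq_sym v0.
move=> u uV; rewrite big_cons (dot_proj u v0); congr (_ + _).
set w := u - _.
have wv : ip w v = 0.
  by rewrite /w linearBl/= linearZl/= mulfVK ?subrr// gt_eqF ?dot_gt0.
have wW : w \in W.
  by rewrite memv_cap memvB ?memvZ//= mem_orthov1; apply/eqP.
(* Each [e] is orthogonal to [v], so removing a multiple of [v] from [u] does not change
   [ip u e]. *)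
rewrite sP//; apply: eq_big_seq => e /sW; rewrite memv_cap => /andP[_].
rewrite mem_orthov1 herm_eq0C => /eqP ve.
by rewrite /w linearBl/= linearZl/= ve mulr0 subr0.
Qed.

Lemma unit_tight_frame_bound N (phi : 'I_N -> H) (A : K) :
  (forall i, ip (phi i) (phi i) = 1) ->
  (forall x, \sum_(i < N) `|ip x (phi i)| ^+ 2 = A * ip x x) ->
  N%:R = A * (\dim {:H})%:R.
Proof.
move=> phi1 tight; have [s <- [_ s0 sP]] := parseval_subspace fullv.
transitivity (\sum_(i < N) ip (phi i) (phi i)).
  by rewrite (eq_bigr _ (fun i _ => phi1 i)) sumr_const card_ord.
rewrite (eq_bigr _ (fun i _ => sP _ (memvf (phi i)))) exchange_big/=.
rewrite (eq_big_seq (fun=> A)).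
  by rewrite big_const_seq count_predT iter_addr_0 mulr_natr.
move=> e es; have e0 : e != 0 by apply: contraNneq s0 => <-.
rewrite -mulr_suml.
(* Swapping the arguments makes the inner sum the frame identity at [e], so every [e] contributes
   exactly [A]. *)
under eq_bigr => i _ do rewrite dot_normC.
by rewrite tight mulfK// gt_eqF ?dot_gt0.
Qed.

End OrthogonalBasis.

Lemma mean_le_prefix (R : realFieldType) N (a : 'I_N -> R) (k : nat) :
  (forall i j : 'I_N, (i <= j)%N -> a j <= a i) -> (k <= N)%N ->
  (\sum_i a i) *+ k <= (\sum_(i < N | (i < k)%N) a i) *+ N.
Proof.
move=> adec kN; rewrite (bigID (fun i : 'I_N => (i < k)%N))/=.
set S := \sum_(i < N | _) a i; set T := \sum_(i < N | ~~ _) a i.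
have cardP : #|[pred i : 'I_N | (i < k)%N]| = k.
  by rewrite -sum1_card (big_ord_narrow kN) sum_nat_const card_ord muln1.
have cardC : #|[pred i : 'I_N | ~~ (i < k)%N]| = (N - k)%N.
  have := cardC [pred i : 'I_N | (i < k)%N]; rewrite card_ord cardP.
  by move/(canRL (addKn k)).
(* Writing N = k + (N - k) and cancelling [S *+ k] leaves [T *+ k <= S *+ (N - k)]. Both sides are
   sums over pairs i < k <= j, where [a j <= a i]. *)
rewrite -[in leRHS](subnKC kN) mulrnDl mulrnDr lerD2l.
have -> : T *+ k = \sum_(i < N | (i < k)%N) T.
  by rewrite sumr_const cardP.
rewrite -sumrMnl ler_sum// => i ik.
rewrite -cardC -sumr_const ler_sum// => j; rewrite -leqNgt => kj.
by apply: adec; rewrite ltnW// (leq_trans ik).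
Qed.

Section Rearrangement.
Variables (R : realType) (N : nat) (a : N.-tuple R).

Lemma nonincreasing_rearrangementP (i j : 'I_N) : (i <= j)%N ->
  tnth (nonincreasing_rearrangement a) j
  <= tnth (nonincreasing_rearrangement a) i.
Proof.
move=> ij; rewrite !(tnth_nth 0)/=.
have := sort_sorted (@ge_total _ R) a.
move=> /(sorted_leq_nth ge_trans ge_refl 0) srt.
by apply: srt; rewrite ?inE ?size_sort ?size_tuple.
Qed.

Lemma sum_nonincreasing_rearrangement :
  \sum_(i < N) tnth (nonincreasing_rearrangement a) i = \sum_(i < N) tnth a i.
Proof.
by rewrite -!(big_tuple _ _ _ predT id); apply: perm_big; rewrite /= perm_sort.
Qed.

Lemma rearrangement_majorizes_mean (c : R) :
  (forall i, 0 <= tnth a i) -> 0 <= c -> \sum_(i < N) tnth a i = c *+ N ->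
  weakly_majorizes (nonincreasing_rearrangement a) [tuple c | i < N].
Proof.
move=> a0 c0 suma; split.
- split=> [i|i j ij]; last exact: nonincreasing_rearrangementP.
  have := mem_tnth i (nonincreasing_rearrangement a).
  by rewrite mem_sort => /tnthP[j ->].
- by split=> [i|i j _]; rewrite !tnth_mktuple.
move=> k /andP[k1 kN].
have := mean_le_prefix nonincreasing_rearrangementP kN.
rewrite sum_nonincreasing_rearrangement suma mulrnAC => le_ck.
(* The factor N can be cancelled because 1 <= k <= N makes it positive. *)
rewrite -(ler_pMn2r (leq_trans k1 kN)); apply: le_trans le_ck.
under eq_bigr do rewrite tnth_mktuple.
by rewrite (big_ord_narrow kN) sumr_const card_ord.
Qed.

End Rearrangement.

Section UnitTightFrame.
Variables (R : realType) (K : numFieldType) (theta : {rmorphism K -> K}).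
Hypothesis sqr_normE : forall z : K, `|z| ^+ 2 = z * theta z.
(** [emb] undoes [re] on non-negative elements, which carries the [R]-valued frame identity into
    [K]; its injectivity brings N = A M back to [R]. *)
Variables (re : K -> R) (emb : {rmorphism R -> K}).
Hypothesis embK : forall z, 0 <= z -> emb (re z) = z.
Hypothesis re_ge0 : forall z, 0 <= z -> 0 <= re z.
Variables (H : vectType K) (ip : {dot H for theta}).

Lemma emb_ip_norm (x : H) : emb (ip_norm re ip x ^+ 2) = ip x x.
Proof. by rewrite sqr_sqrtr ?embK ?re_ge0 ?dot_ge0. Qed.

Lemma unit_tight_frame_majorizes N (phi : 'I_N -> H) (x : H) :
  unit_norm re ip phi -> tight_frame re ip phi -> ip_norm re ip x = 1 ->
  weakly_majorizes (nonincreasing_rearrangement (sq_coefs re ip phi x))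
    [tuple 1 / (\dim {:H})%:R | i < N].
Proof.
move=> phi1 [A A0 tight] x1; set M := \dim _.
have NAM : N%:R = A * M%:R.
  apply: (fmorph_inj emb); rewrite rmorphM !rmorph_nat.
  apply: (unit_tight_frame_bound sqr_normE (ip := ip) (phi := phi)).
    by move=> i; rewrite -emb_ip_norm phi1 expr1n rmorph1.
  move=> y; rewrite -emb_ip_norm -rmorphM -tight rmorph_sum.
  by apply: eq_bigr => i _; rewrite tnth_mktuple rmorphXn/= embK.
(* The zero space contains no unit vector, so the existence of [x] rules out M = 0. *)
have M0 : M%:R != 0 :> R.
  rewrite pnatr_eq0 dimv_eq0; apply/eqP => H0.
  have x0 : x = 0 by apply/eqP; rewrite -memv0 -H0 memvf.
  have := emb_ip_norm x; rewrite x1 x0 linear0r expr1n rmorph1.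
  by move/eqP; rewrite oner_eq0.
apply: rearrangement_majorizes_mean => [i||].
- by rewrite tnth_mktuple exprn_ge0 ?re_ge0.
- by rewrite divr_ge0.
by rewrite tight x1 expr1n mulr1 -[RHS]mulr_natr NAM mul1r mulrCA mulVf ?mulr1.
Qed.

End UnitTightFrame.

Theorem corollary4p5 (R : realType) (M N : nat) :
  (forall (H : vectType R) (ip : {dot H for idfun}) (phi : 'I_N -> H),
     \dim {:H} = M ->
     unit_norm idfun ip phi ->
     tight_frame idfun ip phi ->
     forall x : H, ip_norm idfun ip x = 1 ->
     weakly_majorizes
       (nonincreasing_rearrangement (sq_coefs idfun ip phi x))
       [tuple 1 / M%:R | i < N])
  /\
  (forall (H : vectType R[i]) (ip : {dot H for Num.conj}) (phi : 'I_N -> H),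
     \dim {:H} = M ->
     unit_norm (@complex.Re R) ip phi ->
     tight_frame (@complex.Re R) ip phi ->
     forall x : H, ip_norm (@complex.Re R) ip x = 1 ->
     weakly_majorizes
       (nonincreasing_rearrangement (sq_coefs (@complex.Re R) ip phi x))
       [tuple 1 / M%:R | i < N]).
Proof.
split=> H ip phi <- phi1 tight x x1.
- apply: (@unit_tight_frame_majorizes R R _ _ _ idfun) => // z.
  by rewrite real_normK ?num_real.
(* A non-negative complex number is real, hence recovered from its real part. *)
- apply: (@unit_tight_frame_majorizes R R[i] _ _ _ (real_complex R)) => //.
  + exact: normCK.
  + by move=> z /ger0_real /RRe_real.
  + by move=> z; rewrite lecE => /andP[].
Qed.
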